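(* Let $N\ge 3$ and $K\ge 2$ be integers. For the $(N,3,K)$ HetDAPAC system (defined in the context, with $D=3$), the rate $\frac{2}{3K}$ is achievable. It is achieved by a scheme with load ratio $\frac{2}{3}$ and which requires common randomness of size $\frac{K^2L}{2}$ symbols of $\mathbb{F}_q$, where $L$ is the message length.
   Context: An $(N,D,K)$ heterogeneous distributed attribute-based private access control (HetDAPAC) system is defined as follows. Each user is identified by an attribute vector $\bm{v}=(v_1,\dots,v_N)$ with $v_n\in\mathcal{V}_n$, $|\mathcal{V}_n|=K$ for each $n\in[N]$ (the ordering of each $\mathcal{V}_n$ is public). There are $K^N$ independent messages $W_{\bm{v}}$, one per attribute vector, each consisting of $L$ i.i.d. uniform symbols of a finite field $\mathbb{F}_q$; $\mathcal{W}$ denotes the set of all messages. There are $D+1$ non-colluding, non-communicating servers, each storing all of $\mathcal{W}$ together with a shared common randomness $\mathcal{S}$ consisting of i.i.d. uniform symbols of $\mathbb{F}_q$, independent of $\mathcal{W}$ and of the user's attribute vector, and unknown to the user. The user has a (random) attribute vector $\bm{v}^*=(v^*_1,\dots,v^*_N)$ and wants its designated message $W_{\bm{v}^*}$. Verification phase: for $n\in[D]$ the user reveals $v^*_n$ to server $n$ (a ''dedicated'' server); the user reveals $v^*_{D+1},\dots,v^*_N$ to server $D+1$ (the ''central'' server), which verifies them and announces them to servers $1,\dots,D$. Thus server $n\in[D]$ knows $v^*_n$ and $v^*_{[D+1:N]}$, and server $D+1$ knows only $v^*_{[D+1:N]}$. Access control: server $n\in[D]$ may only use the database $\mathcal{W}^n=\{W_{\bm{v}}: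 v_n=v^*_n,\ v_{[D+1:N]}=v^*_{[D+1:N]}\}$, and server $D+1$ may only use $\mathcal{W}^{D+1}=\{W_{\bm{v}}: v_{[D+1:N]}=v^*_{[D+1:N]}\}$. Retrieval phase: the user sends query $Q_n$ to server $n\in[D+1]$, with $I(Q_1,\dots,Q_{D+1};\mathcal{W})=0$; server $n$ returns an answer $A_n$ that is a deterministic function of $(Q_n,\mathcal{W}^n,\mathcal{S})$. Requirements: (correctness) $H(W_{\bm{v}^*}\mid Q_{[1:D+1]},A_{[1:D+1]})=0$; (attribute privacy) for $n\in[D]$, $I(Q_n; v^*_{[1:D]}\setminus v^*_n \mid \mathcal{S}, v^*_{[D+1:N]}, v^*_n)=0$, and $I(Q_{D+1}; v^*_{[1:D]}\mid \mathcal{S}, v^*_{[D+1:N]})=0$; (database secrecy) $I(\mathcal{W}\setminus\{W_{\bm{v}^*}\}; Q_{[1:D+1]},A_{[1:D+1]})=0$. The rate of a scheme is $L$ divided by the total download cost (total number of $\mathbb{F}_q$ symbols downloaded from all $D+1$ servers); a rate $R$ is achievable if some scheme (for some message length $L$) satisfying all requirements has rate $R$. The load ratio of a scheme (with equal download costs from each dedicated server) is the download cost from any one of servers $1,\dots,D$ divided by the download cost from server $D+1$. *)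

(* Defs.v *)
From HB Require Import structures.
From mathcomp Require Import all_boot all_order all_algebra.
From mathcomp Require Import reals exp.

Set Implicit Arguments.
Unset Strict Implicit.
Unset Printing Implicit Defensive.

Import Order.TTheory GRing.Theory Num.Theory.
Local Open Scope ring_scope.

(* terms with zero probability vanish since they are multiplied by 0.  *)
Section Info.
Variables (R : realType) (Om : finType) (P : Om -> R).

Definition pmf (T : finType) (X : Om -> T) (x : T) : R :=
  \sum_(w | X w == x) P w.

Definition centropy (T1 T2 : finType) (X : Om -> T1) (Y : Om -> T2) : R :=
  - \sum_(x : T1) \sum_(y : T2)
      pmf (fun w => (X w, Y w)) (x, y) *
      ln (pmf (fun w => (X w, Y w)) (x, y) / pmf Y y).

Definition minfo (T1 T2 : finType) (X : Om -> T1) (Y : Om -> T2) : R :=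
  \sum_(x : T1) \sum_(y : T2)
      pmf (fun w => (X w, Y w)) (x, y) *
      ln (pmf (fun w => (X w, Y w)) (x, y) / (pmf X x * pmf Y y)).

Definition cminfo (T1 T2 T3 : finType)
    (X : Om -> T1) (Y : Om -> T2) (Z : Om -> T3) : R :=
  \sum_(x : T1) \sum_(y : T2) \sum_(z : T3)
      pmf (fun w => (X w, Y w, Z w)) (x, y, z) *
      ln (pmf (fun w => (X w, Y w, Z w)) (x, y, z) * pmf Z z /
          (pmf (fun w => (X w, Z w)) (x, z) * pmf (fun w => (Y w, Z w)) (y, z))).

End Info.

Definition is_dist (R : realType) (T : finType) (p : T -> R) : Prop :=
  (forall t, 0 <= p t) /\ \sum_(t : T) p t = 1.

(* Attribute coordinates are 'I_N (paper index n+1 <-> ordinal n);     *)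
(* attribute values are 'I_K.  Servers are 'I_4: ordinals 0,1,2 are    *)
(* the dedicated servers 1,2,3; ordinal 3 is the central server D+1=4. *)
(* Coordinates with value >= 3 are the "central" attributes [4:N].     *)
Definition attr (N K : nat) := {ffun 'I_N -> 'I_K}.
Definition msgs (N K : nat) (F : finFieldType) (L : nat) :=
  {ffun attr N K -> 'rV[F]_L}.

Definition srv0 : 'I_4 := @Ordinal 4 0 isT.
Definition srv1 : 'I_4 := @Ordinal 4 1 isT.
Definition srv2 : 'I_4 := @Ordinal 4 2 isT.
Definition srv3 : 'I_4 := @Ordinal 4 3 isT.

(* [agree n v u]: u and v coincide on the coordinates known to server n
   (coordinate n if n is dedicated, and all central coordinates >= 3).
   Server n knows v* up to [agree n v*], and its database W^n is
   { W_u : agree n v* u }. *)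
Definition agree (N K : nat) (n : 'I_4) (v u : attr N K) : Prop :=
  forall i : 'I_N, (val i == val n) || (3 <= val i)%N -> u i = v i.

(* A scheme: message length L, common randomness of cr_len symbols,
   user's private randomness (finite, with distribution rho), queries
   Q_n = query n v* U, and answers of dl n symbols of F computed by
   server n from (Q_n, v* as known to it, its database, S). *)
Record scheme (N K : nat) (F : finFieldType) (R : realType) := Scheme {
  msg_len : nat;
  cr_len : nat;
  user_rand : finType;
  rho : user_rand -> R;
  qtype : finType;
  query : 'I_4 -> attr N K -> user_rand -> qtype;
  dl : 'I_4 -> nat;
  answer : forall n : 'I_4,
      qtype -> attr N K -> msgs N K F msg_len -> 'rV[F]_cr_len -> 'rV[F]_(dl n)
}.

Arguments msg_len {N K F R} s.
Arguments cr_len {N K F R} s.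
Arguments user_rand {N K F R} s.
Arguments rho {N K F R} s _.
Arguments qtype {N K F R} s.
Arguments query {N K F R} s _ _ _.
Arguments dl {N K F R} s _.
Arguments answer {N K F R} s n _ _ _ _.

Section SchemeDefs.
Variables (N K : nat) (F : finFieldType) (R : realType) (Sc : scheme N K F R).

Local Notation L := (msg_len Sc).
Local Notation s := (cr_len Sc).

Definition Omega := (attr N K * msgs N K F L * 'rV[F]_s * user_rand Sc)%type.

Definition Vr (w : Omega) : attr N K := w.1.1.1.
Definition Wr (w : Omega) : msgs N K F L := w.1.1.2.
Definition Sr (w : Omega) : 'rV[F]_s := w.1.2.
Definition Ur (w : Omega) : user_rand Sc := w.2.

Definition prob (pv : attr N K -> R) (w : Omega) : R :=
  pv (Vr w) * (#|{: msgs N K F L}|%:R)^-1 * (#|{: 'rV[F]_s}|%:R)^-1 * rho Sc (Ur w).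

Definition Qr (n : 'I_4) (w : Omega) : qtype Sc := query Sc n (Vr w) (Ur w).
Definition Ar (n : 'I_4) (w : Omega) : 'rV[F]_(dl Sc n) :=
  answer Sc n (Qr n w) (Vr w) (Wr w) (Sr w).

Definition Qall (w : Omega) : {ffun 'I_4 -> qtype Sc} := [ffun n => Qr n w].
Definition Aall (w : Omega) :=
  (Ar srv0 w, Ar srv1 w, Ar srv2 w, Ar srv3 w).
Definition QAall (w : Omega) := (Qall w, Aall w).

Definition Wdes (w : Omega) : 'rV[F]_L := Wr w (Vr w).

(* W \ {W_{v*}}: the remaining K^N - 1 messages, listed in the public order *)
Definition Wrest (w : Omega) : {ffun 'I_(#|{: attr N K}|).-1 -> 'rV[F]_L} :=
  [ffun j => Wr w (enum_val (lift (enum_rank (Vr w)) j))].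

Definition Vcentral (w : Omega) : {ffun 'I_N -> option 'I_K} :=
  [ffun i => if (3 <= val i)%N then Some (Vr w i) else None].
Definition Vded (w : Omega) : {ffun 'I_N -> option 'I_K} :=
  [ffun i => if (val i < 3)%N then Some (Vr w i) else None].
Definition Vn (n : 'I_4) (w : Omega) : {ffun 'I_N -> option 'I_K} :=
  [ffun i => if val i == val n then Some (Vr w i) else None].
Definition Vother (n : 'I_4) (w : Omega) : {ffun 'I_N -> option 'I_K} :=
  [ffun i => if (val i < 3)%N && (val i != val n) then Some (Vr w i) else None].

(* answers are deterministic functions of (Q_n, W^n, S), given what
   server n knows about v* (access control) *)
Definition access_control : Prop :=
  forall (n : 'I_4) q (v v' : attr N K) (W W' : msgs N K F L) (S : 'rV[F]_s),
    agree n v v' ->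
    (forall u, agree n v u -> W u = W' u) ->
    answer Sc n q v W S = answer Sc n q v' W' S.

Definition valid_scheme : Prop :=
  is_dist (rho Sc) /\ access_control /\
  forall pv : attr N K -> R, is_dist pv ->
    let P := prob pv in
    minfo P Qall Wr = 0 /\
    centropy P Wdes QAall = 0 /\
    (forall n : 'I_4, (val n < 3)%N ->
       cminfo P (Qr n) (Vother n) (fun w => (Sr w, Vcentral w, Vn n w)) = 0) /\
    cminfo P (Qr srv3) Vded (fun w => (Sr w, Vcentral w)) = 0 /\
    minfo P Wrest QAall = 0.

Definition total_download : nat := (dl Sc srv0 + dl Sc srv1 + dl Sc srv2 + dl Sc srv3)%N.

Definition rate : rat := (L%:R / total_download%:R)%R.

Definition equal_dedicated_loads : Prop :=
  dl Sc srv0 = dl Sc srv1 /\ dl Sc srv1 = dl Sc srv2.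

Definition load_ratio : rat := ((dl Sc srv0)%:R / (dl Sc srv3)%:R)%R.

End SchemeDefs.

(* Main.v *)
(* A message has six symbols, indexed by [(i, t)] with [i] in Z/3 and [t] in {0, 1}.
   For each [i], the servers [i], [i + 1] and the central one retrieve the two
   symbols [(i, 0)] and [(i, 1)].  Write (a, b, c) for the attributes number
   [i], [i + 1], [i + 2], let [u] be a uniform key, and put
     P_q(a, b) = sum_{c, t} q(b, c, t) W_{a, b, c}(i, t) + S(a, b).
   Server [i] returns P_u(a*, b) for all [b]; server [i + 1] returns P_q(a, b* )
   for all [a], where [q] is [u] shifted at (b*, c*, 0); the central server returns
   sum_b P_q(a, b) for all [a], where [q] is [u] shifted at (b*, c*, 1).
   The first two servers share the mask S(a*, b* ), so their answers differ by
   W*(i, 0); the first and the last share sum_b S(a*, b), which gives W*(i, 1).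
   All other masks are independent, since K > 1.  Rotating [i] balances the loads.

   Each information-theoretic requirement holds because a group of translations of
   the sample space preserves the law: translating the key hides the attributes, and
   any change of the undesired messages is absorbed by a change of the masks. *)
Require Import Defs.
From HB Require Import structures.
From mathcomp Require Import all_boot all_order all_algebra.
From mathcomp Require Import reals exp.
From mathcomp Require Import ring.

Set Implicit Arguments.
Unset Strict Implicit.
Unset Printing Implicit Defensive.

Import Order.TTheory GRing.Theory Num.Theory.
Local Open Scope ring_scope.

(** * Criteria for vanishing entropy and mutual information *)

Section Information.
Variables (R : realType) (Om : finType) (P : Om -> R).

Lemma pmf_pair_suml (T1 T2 : finType) (X : Om -> T1) (Y : Om -> T2) y :
  \sum_x pmf P (fun w => (X w, Y w)) (x, y) = pmf P Y y.
Proof.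
rewrite /pmf [RHS](partition_big X xpredT) //=.
by apply: eq_bigr => x _; apply: eq_bigl => w; rewrite xpair_eqE andbC.
Qed.

Lemma pmf_pair_sumr (T1 T2 : finType) (X : Om -> T1) (Y : Om -> T2) x :
  \sum_y pmf P (fun w => (X w, Y w)) (x, y) = pmf P X x.
Proof.
by rewrite /pmf [RHS](partition_big Y xpredT).
Qed.

Lemma pmf_reindex (T : finType) (X : Om -> T) (f : Om -> Om) x x' :
  injective f -> (forall w, P (f w) = P w) ->
  (forall w, (X (f w) == x') = (X w == x)) -> pmf P X x = pmf P X x'.
Proof.
move=> f_inj Pf Xf; rewrite /pmf [RHS](reindex_inj f_inj) /=.
by apply: eq_big => // w; rewrite ?Pf ?Xf.
Qed.

Lemma mul_ln_div_diag (a b : R) : a = b -> a * ln (a / b) = 0.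
Proof.
move=> <-; have [->|a0] := eqVneq a 0; first by rewrite mul0r.
by rewrite divff // ln1 mulr0.
Qed.

Lemma minfoC (T1 T2 : finType) (X : Om -> T1) (Y : Om -> T2) :
  minfo P X Y = minfo P Y X.
Proof.
rewrite /minfo exchange_big; apply: eq_bigr => y _; apply: eq_bigr => x _.
have -> : pmf P (fun w => (X w, Y w)) (x, y) = pmf P (fun w => (Y w, X w)) (y, x).
  by apply: eq_bigl => w; rewrite !xpair_eqE andbC.
by rewrite [pmf P X x * _]mulrC.
Qed.

(** The symmetries make the joint law constant in [x] for each [y]; so [X] is uniform and
    independent of [Y]. *)
Lemma minfo_transitive (T1 T2 : finType) (X : Om -> T1) (Y : Om -> T2) :
  \sum_w P w = 1 ->
  (forall x x', exists f : Om -> Om,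
     [/\ injective f, forall w, P (f w) = P w, forall w, Y (f w) = Y w
       & forall w, (X (f w) == x') = (X w == x)]) ->
  minfo P X Y = 0.
Proof.
move=> P1 tr.
have joint x x' y : pmf P (fun w => (X w, Y w)) (x, y)
                  = pmf P (fun w => (X w, Y w)) (x', y).
  have [f [f_inj Pf Yf Xf]] := tr x x'.
  by apply: (pmf_reindex f_inj) => // w; rewrite !xpair_eqE Yf Xf.
rewrite /minfo big1 // => x _; rewrite big1 // => y _; apply: mul_ln_div_diag.
have n0 : #|T1|%:R != 0 :> R by rewrite pnatr_eq0 -lt0n; apply/card_gt0P; exists x.
have pX x' : pmf P X x' = pmf P X x.
  by rewrite -!(pmf_pair_sumr X Y); apply: eq_bigr => y' _; apply: joint.
have -> : pmf P Y y = #|T1|%:R * pmf P (fun w => (X w, Y w)) (x, y).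
  rewrite -(pmf_pair_suml X) (eq_bigr _ (fun x' _ => joint x' x y)).
  by rewrite sumr_const mulr_natl.
have : #|T1|%:R * pmf P X x = 1.
  rewrite mulr_natl -P1 (partition_big X xpredT) //= -[RHS]/(\sum_x' pmf P X x').
  by rewrite (eq_bigr _ (fun x' _ => pX x')) sumr_const.
by rewrite mulrA [pmf P X x * _]mulrC => ->; rewrite mul1r.
Qed.

Lemma centropy_determined (T1 T2 : finType) (X : Om -> T1) (Y : Om -> T2) :
  (forall w w', Y w = Y w' -> X w = X w') -> centropy P X Y = 0.
Proof.
move=> XY; rewrite /centropy big1 ?oppr0 // => x _; rewrite big1 // => y _.
case: (pickP [pred w | (X w, Y w) == (x, y)]) => [w0|no].
  rewrite /= xpair_eqE => /andP[/eqP Xw /eqP Yw].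
  apply: mul_ln_div_diag; apply: eq_bigl => w; rewrite xpair_eqE.
  by apply: andb_idl => /eqP Yw'; rewrite -Xw (XY w w0) // Yw' Yw.
by rewrite {1}/pmf big_pred0 ?mul0r.
Qed.

End Information.

(** Y - Z - X is a Markov chain: given [t], the law of [X] is a kernel in [Z t] alone. In the
    application [T] carries attributes, messages and masks, and [U] the key. *)
Lemma cminfo_kernel (R : realType) (T U T1 T2 T3 : finType)
    (p : T -> R) (rho : U -> R) (P : T * U -> R)
    (X : T * U -> T1) (Y : T -> T2) (Z : T -> T3) :
  (forall w, P w = p w.1 * rho w.2) ->
  (forall t t' x, Z t = Z t' ->
     \sum_(u | X (t, u) == x) rho u = \sum_(u | X (t', u) == x) rho u) ->
  \sum_u rho u = 1 ->
  cminfo P X (fun w => Y w.1) (fun w => Z w.1) = 0.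
Proof.
move=> PE XZ rho1.
(* The kernel, read off at any representative of the fibre of [Z] over [z]. On an empty fibre the
   joint masses are 0, so the default is harmless. *)
pose kap z x := if [pick t | Z t == z] is Some t
  then \sum_(u | X (t, u) == x) rho u else 0.
have pyz y z : pmf P (fun w => (Y w.1, Z w.1)) (y, z)
             = \sum_(t | (Y t, Z t) == (y, z)) p t.
  rewrite /pmf (eq_bigr _ (fun w _ => PE w)).
  rewrite (eq_bigl (fun w : T * U => ((Y w.1, Z w.1) == (y, z)) && true));
    last by move=> w; rewrite andbT.
  rewrite -(pair_big_dep (fun t => (Y t, Z t) == (y, z)) (fun _ _ => true)
             (fun t u => p t * rho u)) /=.
  by apply: eq_bigr => t _; rewrite -mulr_sumr rho1 mulr1.
have pxyz x y z : pmf P (fun w => (X w, Y w.1, Z w.1)) (x, y, z)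
    = kap z x * pmf P (fun w => (Y w.1, Z w.1)) (y, z).
  rewrite pyz mulr_sumr /pmf (eq_bigr _ (fun w _ => PE w)).
  rewrite (eq_bigl (fun w : T * U =>
    ((Y w.1, Z w.1) == (y, z)) && (X (w.1, w.2) == x))); last first.
    by case=> t u /=; rewrite !xpair_eqE [RHS]andbC andbA.
  rewrite -(pair_big_dep (fun t => (Y t, Z t) == (y, z))
             (fun t u => X (t, u) == x) (fun t u => p t * rho u)) /=.
  apply: eq_bigr => t; rewrite xpair_eqE => /andP[_ /eqP Zt].
  rewrite -mulr_sumr mulrC /kap; case: pickP => [t' /eqP Zt'|/(_ t)].
    by rewrite (XZ t t' x) // Zt Zt'.
  by rewrite Zt eqxx.
have pxz x z : pmf P (fun w => (X w, Z w.1)) (x, z)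
             = kap z x * pmf P (fun w => Z w.1) z.
  rewrite -(pmf_pair_suml _ (fun w => Y w.1)).
  rewrite -(pmf_pair_suml _ (fun w => Y w.1)) mulr_sumr.
  apply: eq_bigr => y _; rewrite -pxyz; apply: eq_bigl => w.
  by rewrite !xpair_eqE andbCA andbA.
rewrite /cminfo big1 // => x _; rewrite big1 // => y _; rewrite big1 // => z _.
rewrite pxz pxyz.
set a := pmf _ _ z; set b := pmf _ _ _; set c := kap _ _.
have [->|cb0] := eqVneq (c * b) 0; first by rewrite mul0r.
(* Here the argument of [ln] is 0, where [ln] takes the value 0. *)
have [->|a0] := eqVneq a 0.
  by rewrite !(mulr0, mul0r) ln0 ?mulr0.
move: cb0; rewrite mulf_eq0 negb_or => /andP[c0 b0].
by rewrite [c * b * a]mulrAC divff ?mulf_neq0 // ln1 mulr0.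
Qed.

Lemma sum_uniform (R : realType) (T : finType) (t : T) : \sum_(x : T) (#|T|%:R : R)^-1 = 1.
Proof.
rewrite sumr_const -[LHS]mulr_natl divff // pnatr_eq0 -lt0n.
by apply/card_gt0P; exists t.
Qed.

Lemma sum_uniform_pair (R : realType) (T U : finType) (u : U) (p : T -> R) :
  \sum_(w : T * U) p w.1 / #|U|%:R = \sum_t p t.
Proof.
rewrite -(pair_big xpredT xpredT (fun t _ => p t / #|U|%:R)) /=.
by apply: eq_bigr => t _; rewrite -mulr_sumr (sum_uniform R u) mulr1.
Qed.

Lemma addrB_eq (V : zmodType) (x y z : V) : (x + (z - y) == z) = (x == y).
Proof. by rewrite addrCA -{2}[z]addr0 (inj_eq (addrI z)) subr_eq0. Qed.

(** * The scheme *)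

Section Construction.
Variables (N k : nat) (F : finFieldType) (R : realType).
Hypothesis N3 : (3 <= N)%N.

(** In this form ['I_K] is the nontrivial ring Z/K, so that b + 1 makes sense and differs from b. *)
Local Notation K := k.+2.
Local Notation L := (3 * 2)%N.
Local Notation crl := (3 * (K * K))%N.
Local Notation keyT := {ffun 'I_3 * 'I_K * 'I_K * 'I_2 -> F}.

Definition att (v : attr N K) (i : 'I_3) : 'I_K := v (widen_ord N3 i).

Definition place (v : attr N K) (i : 'I_3) (a b c : 'I_K) : attr N K :=
  [ffun x => if val x == val i then a else
             if val x == val (i + 1) then b else
             if val x == val (i + 2) then c else v x].

(* The P_q(a, b) of sub-scheme [i]. *)
Definition share (q : keyT) (v : attr N K) (W : msgs N K F L) (S : 'rV[F]_crl)
    (i : 'I_3) (a b : 'I_K) : F :=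
  \sum_c \sum_t q (i, b, c, t) * W (place v i a b c) 0 (mxvec_index i t)
  + S 0 (mxvec_index i (mxvec_index a b)).

(** The number of sub-schemes in which server [n] takes part; each costs it K symbols. *)
Definition blocks (n : 'I_4) : nat := if val n == 3 then 3 else 2.

(* Row [r] of an answer belongs to sub-scheme [r] for the central server; a dedicated
   server [i] acts as first server of sub-scheme [i] if [r = 0], and as second server
   of sub-scheme [i - 1] if [r = 1]. *)
Definition reply (n : 'I_4) (q : keyT) (v : attr N K) (W : msgs N K F L)
    (S : 'rV[F]_crl) (r : nat) (x : 'I_K) : F :=
  if val n == 3 then \sum_b share q v W S (inord r) x b
  else let i := inord (val n) in
    if r == 0 then share q v W S i (att v i) x
    else share q v W S (i - 1) x (att v i).

(** The key entries that enter the answer of server [n]. They depend on [v] only through attribute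
    [n], which that server knows, so blanking the others leaks nothing. *)
Definition visible (n : 'I_4) (v : attr N K) (d : 'I_3 * 'I_K * 'I_K * 'I_2) :=
  let: (i, b, _, _) := d in
  [|| val n == 3, val n == val i
    | (val n == val (i + 1)) && (b == att v (i + 1))].

Definition target (n : 'I_4) (v : attr N K) (d : 'I_3 * 'I_K * 'I_K * 'I_2) :=
  let: (i, b, c, t) := d in
  [&& (val n == 3) && (t == 1) || (val n == val (i + 1)) && (t == 0),
      b == att v (i + 1) & c == att v (i + 2)].

Definition offset (n : 'I_4) (v : attr N K) : keyT := [ffun d => (target n v d)%:R].

Definition ask (n : 'I_4) (v : attr N K) (u : keyT) : keyT :=
  [ffun d : 'I_3 * 'I_K * 'I_K * 'I_2 => if visible n v d then (u + offset n v) d else 0].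

Definition balanced_scheme : scheme N K F R :=
  @Scheme N K F R L crl keyT (fun _ => (#|{: keyT}|%:R)^-1) keyT ask
    (fun n => blocks n * K)%N
    (fun n q v W S => mxvec (\matrix_(r < blocks n, x < K) reply n q v W S r x)).

(** * Access control *)

Lemma attE (v : attr N K) (x : 'I_N) (i : 'I_3) : val x = val i -> v x = att v i.
Proof. by move=> xi; congr (fun_of_fin v _); apply: val_inj. Qed.

Lemma place_id v i : place v i (att v i) (att v (i + 1)) (att v (i + 2)) = v.
Proof.
by apply/ffunP => x; rewrite ffunE; do 3![case: eqP => [/attE->//|_]].
Qed.

Lemma rotations (i : 'I_3) (m : nat) : (m < 3)%N ->
  [|| m == val i, m == val (i + 1) | m == val (i + 2)].
Proof. by case: i m => [[|[|[|//]]] ?] [|[|[|//]]]. Qed.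

Lemma place_ge3 v i a b c (x : 'I_N) : (3 <= val x)%N -> place v i a b c x = v x.
Proof.
move=> x3; rewrite ffunE.
have ne (i' : 'I_3) : (val x == val i') = false.
  by apply: contraTF x3 => /eqP ->; rewrite -ltnNge ltn_ord.
by rewrite !ne.
Qed.

(** [place] overwrites all dedicated coordinates, and every server knows the central ones. *)
Lemma place_central n v v' i a b c :
  agree n v v' -> place v i a b c = place v' i a b c.
Proof.
move=> vv'; apply/ffunP => x; rewrite !ffunE.
case: (ltnP (val x) 3) => [/(rotations i)|x3]; last by rewrite vv' // orbC x3.
by case: eqP => // _; case: eqP => // _; case: eqP.
Qed.

Lemma agree_att n (i : 'I_3) v v' : agree n v v' -> val n = val i -> att v i = att v' i.
Proof. by move=> vv' ni; rewrite /att vv' //= ni eqxx. Qed.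

Lemma scheme_access_control : access_control balanced_scheme.
Proof.
move=> n q v v' W W' S vv' WW' /=; congr mxvec; apply/matrixP => r x.
rewrite !mxE /reply.
have sh i a b : (forall c, agree n v (place v i a b c)) ->
    share q v W S i a b = share q v' W' S i a b.
  move=> ag; congr (_ + _); apply: eq_bigr => c _; apply: eq_bigr => t _.
  by rewrite -(place_central _ _ _ _ vv') WW'.
have [n3|n3] := eqVneq (val n) 3.
  apply: eq_bigr => b _; apply: sh => c y; rewrite n3 => y3.
  by rewrite place_ge3 //; case/orP: y3 => [/eqP->|].
have ni : val n = val (inord (val n) : 'I_3).
  by rewrite /= inordK //; move: n3 (ltn_ord n); rewrite ltnS leq_eqVlt => /negPf->.
rewrite -(agree_att vv' ni); set i := inord _ in ni *.
case: eqP => _; apply: sh => c y => /orP[|y3].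
- by rewrite ffunE ni => /eqP yi; rewrite yi eqxx (attE v yi).
- by rewrite place_ge3.
- rewrite ffunE ni => /eqP yi; rewrite yi subrK eqxx.
  (* The known attribute sits in slot b of sub-scheme [i - 1]; [place] tests slot a first, so that
     test has to fail. *)
  have -> : (val i == val (i - 1)) = false by case: (i) => [[|[|[|//]]] ?].
  by rewrite (attE v yi).
by rewrite place_ge3.
Qed.

(** * Decoding *)

Definition srv (i : 'I_3) : 'I_4 := widen_ord (isT : (3 <= 4)%N) i.

Lemma val_srv i : val (srv i) = val i. Proof. by []. Qed.

Lemma serverP n : n = srv3 \/ exists i, n = srv i.
Proof.
case: n => [[|[|[|[|//]]]] p]; last by left; apply: val_inj.
- by right; exists 0; apply: val_inj.
- by right; exists 1; apply: val_inj.
- by right; exists 2; apply: val_inj.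
Qed.

Lemma reply_central q v W S (i : 'I_3) x :
  reply srv3 q v W S i x = \sum_b share q v W S i x b.
Proof. by rewrite /reply /= inord_val. Qed.

Lemma reply_dedicated i q v W S r x :
  reply (srv i) q v W S r x = if r == 0 then share q v W S i (att v i) x
    else share q v W S (i - 1) x (att v i).
Proof.
rewrite /reply /= inord_val; case: eqP => // i3.
by move: (ltn_ord i); rewrite i3.
Qed.

Lemma ord3_neq_succ (i : 'I_3) : (val i == val (i + 1)) = false.
Proof. by case: i => [[|[|[|//]]] ?]. Qed.

Lemma ord3_neq3 (i : 'I_3) : (val i == 3) = false.
Proof. by case: i => [[|[|[|//]]] ?]. Qed.

Lemma share_ask_first u v W S i a b :
  share (ask (srv i) v u) v W S i a b = share u v W S i a b.
Proof.
congr (_ + _); apply: eq_bigr => c _; apply: eq_bigr => t _; congr (_ * _).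
rewrite !ffunE /visible /target val_srv eqxx orbT.
by rewrite ord3_neq_succ ord3_neq3 addr0.
Qed.

(** A share is affine in the key, so a unit shift at one entry of row b* adds exactly one message
    symbol there. *)
Lemma share_target (q u : keyT) v W S i a b t0 :
  (forall c t, q (i, b, c, t) = u (i, b, c, t) +
     [&& t == t0, b == att v (i + 1) & c == att v (i + 2)]%:R) ->
  share q v W S i a b = share u v W S i a b +
    (if b == att v (i + 1) then W (place v i a b (att v (i + 2))) 0 (mxvec_index i t0)
     else 0).
Proof.
move=> qE; rewrite /share addrAC; congr (_ + _).
under eq_bigr => c _ do under eq_bigr => t _ do rewrite qE mulrDl.
under eq_bigr => c _ do rewrite big_split.
rewrite big_split /=; congr (_ + _).
case: eqP => _; last first.
  by rewrite big1 // => c _; rewrite big1 // => t _; rewrite andbF mul0r.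
rewrite (bigD1 (att v (i + 2))) //= [X in _ + X]big1 ?addr0; last first.
  by move=> c /negPf c0; rewrite big1 // => t _; rewrite c0 andbF mul0r.
rewrite (bigD1 t0) //= [X in _ + X]big1 ?addr0 ?eqxx ?mul1r //.
by move=> t /negPf ->; rewrite mul0r.
Qed.

Lemma share_ask_second u v W S i a :
  share (ask (srv (i + 1)) v u) v W S i a (att v (i + 1)) =
  share u v W S i a (att v (i + 1)) +
  W (place v i a (att v (i + 1)) (att v (i + 2))) 0 (mxvec_index i 0).
Proof.
rewrite (@share_target _ u v W S i a _ 0) ?eqxx // => c t.
by rewrite !ffunE /visible /target val_srv !eqxx !orbT ord3_neq3 andTb.
Qed.

Lemma share_ask_central u v W S i a b :
  share (ask srv3 v u) v W S i a b = share u v W S i a b +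
    (if b == att v (i + 1) then W (place v i a b (att v (i + 2))) 0 (mxvec_index i 1)
     else 0).
Proof.
apply: share_target => c t; rewrite !ffunE /visible /target eqxx orTb andTb.
by rewrite [val srv3 == val (i + 1)]eq_sym ord3_neq3 orbF.
Qed.

Lemma sum_share_ask_central u v W S i a :
  \sum_b share (ask srv3 v u) v W S i a b = \sum_b share u v W S i a b +
    W (place v i a (att v (i + 1)) (att v (i + 2))) 0 (mxvec_index i 1).
Proof.
under eq_bigr => b _ do rewrite share_ask_central.
by rewrite big_split /= -big_mkcond big_pred1_eq.
Qed.

Lemma decode_first u v (W : msgs N K F L) S i :
  W v 0 (mxvec_index i 0) =
    reply (srv (i + 1)) (ask (srv (i + 1)) v u) v W S 1 (att v i)
    - reply (srv i) (ask (srv i) v u) v W S 0 (att v (i + 1)).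
Proof.
by rewrite !reply_dedicated /= addrK share_ask_second share_ask_first place_id addrC addKr.
Qed.

Lemma decode_second u v (W : msgs N K F L) S i :
  W v 0 (mxvec_index i 1) =
    reply srv3 (ask srv3 v u) v W S i (att v i)
    - \sum_b reply (srv i) (ask (srv i) v u) v W S 0 b.
Proof.
under eq_bigr => b _ do rewrite reply_dedicated /= share_ask_first.
by rewrite reply_central sum_share_ask_central place_id addrC addKr.
Qed.

(** * Absorbing a change of messages into the masks *)

Lemma shareD q v W W' S S' i a b :
  share q v (W + W') (S + S') i a b = share q v W S i a b + share q v W' S' i a b.
Proof.
rewrite /share mxE addrACA -big_split; congr (_ + _); apply: eq_bigr => c _.
by rewrite -big_split; apply: eq_bigr => t _; rewrite ffunE mxE mulrDr.
Qed.

(** With the query fixed, a translation of messages and masks preserves the answers as soon as the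
    reply to the translation itself is zero. *)
Lemma replyD n q v W W' S S' r x :
  reply n q v (W + W') (S + S') r x = reply n q v W S r x + reply n q v W' S' r x.
Proof.
rewrite /reply; case: ifP => _; last by case: ifP => _; apply: shareD.
by rewrite -big_split; apply: eq_bigr => b _; apply: shareD.
Qed.

(* Cancels the effect of the messages [W] on all answers. Off the line [a = a*], the
   answers constrain only the entry at [b*] and the sum over [b]; the entry at
   [b* + 1], which differs from [b*] as K > 1, is free to adjust the sum. *)
Definition compensation_entry (v : attr N K) (u : keyT) (W : msgs N K F L) (i : 'I_3)
    (a b : 'I_K) : F :=
  if a == att v i then - share u v W 0 i a b
  else if b == att v (i + 1) then - share (ask (srv (i + 1)) v u) v W 0 i a b
  else if b == att v (i + 1) + 1 then
    share (ask (srv (i + 1)) v u) v W 0 i a (att v (i + 1))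
    - \sum_b' share (ask srv3 v u) v W 0 i a b'
  else 0.

Definition compensation (v : attr N K) (u : keyT) (W : msgs N K F L) : 'rV[F]_crl :=
  mxvec (\matrix_(i < 3) mxvec (\matrix_(a < K, b < K) compensation_entry v u W i a b)).

Lemma share_compensation q v u W i a b :
  share q v W (compensation v u W) i a b = share q v W 0 i a b + compensation_entry v u W i a b.
Proof. by rewrite /share /compensation !mxvecE !mxE addr0 mxvecE mxE. Qed.

(** On the line a = a*, one set of masks serves all servers, whose unmasked answers differ only by
    symbols of [W v], hence not at all. Off that line only the second and the central server
    constrain the masks. *)
Lemma reply_compensation n v u (W : msgs N K F L) r x : W v = 0 -> (r < blocks n)%N ->
  reply n (ask n v u) v W (compensation v u W) r x = 0.
Proof.
move=> W0; case: (serverP n) => [->|[i ->]] rn.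
  have -> : r = val (Ordinal rn : 'I_3) by [].
  move: (Ordinal rn : 'I_3) => i; rewrite reply_central.
  under eq_bigr => b _ do rewrite share_compensation.
  rewrite big_split /= /compensation_entry; case: eqP => [->|_].
    rewrite sum_share_ask_central place_id W0 mxE addr0 -big_split.
    by rewrite big1 // => b _; rewrite /= subrr.
  have s1 (y : 'I_K) : (y + 1 == y) = false.
    by rewrite -subr_eq0 addrAC subrr add0r oner_eq0.
  (* The entries at b* and b* + 1 add up to [- A]. *)
  set A := \sum_b share _ _ _ _ _ _ _.
  rewrite (bigD1 (att v (i + 1))) //= eqxx.
  rewrite (bigD1 (att v (i + 1) + 1)) ?s1 //= eqxx big1 ?addr0.
    by rewrite addKr subrr.
  by move=> b /andP[/negPf-> /negPf->].
rewrite reply_dedicated; case: eqP => _.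
  by rewrite share_compensation share_ask_first /compensation_entry eqxx subrr.
(* Rename the server as [j + 1], the second one of sub-scheme [j]. *)
move: (subrK 1 i) => <-; move: (i - 1) => j; rewrite addrK.
rewrite share_compensation /compensation_entry eqxx; case: eqP => [->|_]; last by rewrite subrr.
by rewrite share_ask_second place_id W0 mxE addr0 subrr.
Qed.

(** * The information-theoretic requirements *)

Local Notation Om := (Omega balanced_scheme).

Lemma sum_prob pv : is_dist pv -> \sum_w prob (Sc := balanced_scheme) pv w = 1.
Proof.
case=> _ <-.
apply: etrans (sum_uniform_pair (0 : msgs N K F L) pv).
apply: etrans (sum_uniform_pair (0 : 'rV[F]_crl) _).
exact: (sum_uniform_pair (0 : keyT)).
Qed.

(** Messages and masks are uniform, so this preserves the law; the shifts may depend on attributes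
    and key, which stay fixed. *)
Definition translate (f : attr N K -> msgs N K F L)
    (g : attr N K -> keyT -> 'rV[F]_crl) (w : Om) : Om :=
  (Vr w, Wr w + f (Vr w), Sr w + g (Vr w) (Ur w), Ur w).

Lemma translate_inj f g : injective (translate f g).
Proof.
move=> [[[v W] S] u] [[[v' W'] S'] u']; rewrite /translate /Vr /Wr /Sr /Ur /=.
by case=> -> /addIr -> eS uu; move: eS; rewrite uu => /addIr ->.
Qed.

Lemma queries_independent_messages pv : is_dist pv ->
  minfo (prob (Sc := balanced_scheme) pv) (@Qall _ _ _ _ balanced_scheme)
    (@Wr _ _ _ _ balanced_scheme) = 0.
Proof.
move=> /sum_prob P1; rewrite minfoC; apply: minfo_transitive => // W W'.
exists (translate (fun _ => W' - W) (fun _ _ => 0)); split=> [|w|w|w].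
- exact: translate_inj.
- by [].
- by [].
- exact: (addrB_eq (Wr w) W W').
Qed.

Lemma database_secrecy pv : is_dist pv ->
  minfo (prob (Sc := balanced_scheme) pv) (@Wrest _ _ _ _ balanced_scheme)
    (@QAall _ _ _ _ balanced_scheme) = 0.
Proof.
move=> /sum_prob P1; apply: minfo_transitive => // r r'.
(* Moves the undesired messages from [r] to [r']; [unlift] fails exactly at [v], so the designated
   message is kept. *)
pose f (v : attr N K) : msgs N K F L := [ffun x =>
  if unlift (enum_rank v) (enum_rank x) is Some j then r' j - r j else 0].
exists (translate f (fun v u => compensation v u (f v))); split=> [|w|w|w].
- exact: translate_inj.
- by [].
- case: w => [[[v W] S] u].
  have f0 : f v v = 0 by rewrite ffunE unlift_none.
  have ArE n : Ar (Sc := balanced_scheme) n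
      (translate f (fun v u => compensation v u (f v)) (v, W, S, u))
      = Ar n (v, W, S, u).
    rewrite /Ar /=; congr mxvec; apply/matrixP => i x; rewrite !mxE.
    by rewrite replyD reply_compensation ?addr0.
  by rewrite /QAall /Aall !ArE.
rewrite -(addrB_eq (Wrest w) r r'); congr (_ == _).
by apply/ffunP => j; rewrite !ffunE enum_valK [Vr (translate _ _ _)]/(Vr w) liftK.
Qed.

(** Stated for any [Z] that reveals at least what server [n] knows, so as to cover the dedicated and
    the central servers at once. *)
Lemma attribute_privacy n pv (T1 T2 : finType) (Y : attr N K * msgs N K F L * 'rV[F]_crl -> T1)
    (Z : attr N K * msgs N K F L * 'rV[F]_crl -> T2) :
  (forall t t', Z t = Z t' -> agree n t.1.1 t'.1.1) ->
  cminfo (prob (Sc := balanced_scheme) pv)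
    (@Qr _ _ _ _ balanced_scheme n) (fun w => Y w.1) (fun w => Z w.1) = 0.
Proof.
move=> Zag; apply: (cminfo_kernel (rho := rho balanced_scheme)
  (p := fun t => pv t.1.1 / #|{: msgs N K F L}|%:R / #|{: 'rV[F]_crl}|%:R)).
- by [].
- move=> [[v W] S] [[v' W'] S'] x /Zag /= ag; rewrite /Qr /=.
  (* Translating the uniform key by the difference of the offsets turns one query into the other. *)
  rewrite [LHS](reindex_inj (addIr (offset n v' - offset n v))) /=.
  apply: eq_bigl => u; congr (_ == x); apply/ffunP => d; rewrite !ffunE -addrA subrK.
  congr (if _ then _ else _); case: d => [[[i b] c] t] /=.
  congr [|| _, _ | _]; case: eqP => //= ni; congr (_ == _).
  by rewrite (agree_att ag).
exact: (sum_uniform R (0 : keyT)).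
Qed.

Lemma answers_determine (w w' : Om) : Aall w = Aall w' -> forall n, Ar n w = Ar n w'.
Proof.
move=> [e0 e1 e2 e3] [[|[|[|[|//]]]] p].
- by rewrite (_ : Ordinal p = srv0) //; apply: val_inj.
- by rewrite (_ : Ordinal p = srv1) //; apply: val_inj.
- by rewrite (_ : Ordinal p = srv2) //; apply: val_inj.
- by rewrite (_ : Ordinal p = srv3) //; apply: val_inj.
Qed.

(** The decoder is given neither key nor attributes: the first servers reveal the unshifted key, and
    the shift of the central query then reveals the dedicated attributes. *)
Lemma queries_determine v v' u u' : (forall n, ask n v u = ask n v' u') ->
  u = u' /\ forall i, att v i = att v' i.
Proof.
move=> e; have uu : u = u'.
  apply/ffunP => [[[[i b] c] t]].
  have := congr1 (fun q : keyT => q (i, b, c, t)) (e (srv i)).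
  by rewrite !ffunE /visible /target val_srv eqxx orbT ord3_neq_succ ord3_neq3 !addr0.
split=> // i; rewrite -{}uu in e.
(* Attribute [i] is b* in sub-scheme [i - 1], and this entry is the one shifted there for [v]; it
   must then be shifted for [v'] too. *)
have := congr1 (fun q : keyT => q (i - 1, att v i, att v (i + 1), 1)) (e srv3).
rewrite !ffunE /visible /target !eqxx !orTb => /addrI; rewrite subrK.
have -> : i - 1 + 2 = i + 1 by rewrite -addrA; congr (_ + _); apply: val_inj.
by rewrite !eqxx; case: eqP => // _ /eqP; rewrite oner_eq0.
Qed.

(** Central attributes may differ between two samples with equal queries and answers, but the
    decoding formulas read only the dedicated ones. *)
Lemma correctness pv :
  centropy (prob (Sc := balanced_scheme) pv) (@Wdes _ _ _ _ balanced_scheme)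
    (@QAall _ _ _ _ balanced_scheme) = 0.
Proof.
apply: centropy_determined => [[[[v W] S] u]] [[[v' W'] S'] u'] e.
have /ffunP eQ := congr1 fst e; have eA := congr1 snd e.
have /queries_determine [uu vv] : forall n, ask n v u = ask n v' u'.
  by move=> n; have := eQ n; rewrite !ffunE.
have eR n r x : (r < blocks n)%N ->
    reply n (ask n v u) v W S r x = reply n (ask n v' u') v' W' S' r x.
  move=> rn; have /(congr1 vec_mx) := answers_determine eA n.
  rewrite !mxvecK => /matrixP /(_ (Ordinal rn) x).
  by rewrite !mxE.
have b1 n : (1 < blocks n)%N by rewrite /blocks; case: ifP.
have b0 n : (0 < blocks n)%N by apply: ltnW.
apply/rowP => j; rewrite /Wdes /Wr /Vr /=.
case/mxvec_indexP: j => i t; have [->|->] : t = 0 \/ t = 1.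
- by case: t => [[|[|//]] p]; [left|right]; apply: val_inj.
- by rewrite (decode_first u v W S) (decode_first u' v' W' S') !eR ?b0 ?b1 // !vv.
rewrite (decode_second u v W S) (decode_second u' v' W' S') eR //.
rewrite vv; congr (_ - _); apply: eq_bigr => b _; exact/eR/b0.
Qed.

Lemma scheme_valid : valid_scheme balanced_scheme.
Proof.
split.
  by split=> [u|]; [rewrite invr_ge0 ler0n | exact: (sum_uniform R (0 : keyT))].
split; first exact: scheme_access_control.
move=> pv dpv /=; split; first exact: queries_independent_messages.
split; first exact: correctness.
split; [move=> n n3 | split; last exact: database_secrecy].
  apply: (@attribute_privacy n pv _ _
    (fun t => [ffun i => if (val i < 3)%N && (val i != val n) then Some (t.1.1 i) else None])
    (fun t => (t.2,
      [ffun i : 'I_N => if (3 <= val i)%N then Some (t.1.1 i) else None],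
      [ffun i : 'I_N => if val i == val n then Some (t.1.1 i) else None]))).
  move=> [[v W] S] [[v' W'] S'] [_ /ffunP ec /ffunP en] x.
  case/orP=> xn; [have := en x | have := ec x];
    by rewrite !ffunE /= xn => -[].
apply: (@attribute_privacy srv3 pv _ _
  (fun t => [ffun i => if (val i < 3)%N then Some (t.1.1 i) else None])
  (fun t => (t.2, [ffun i : 'I_N => if (3 <= val i)%N then Some (t.1.1 i) else None]))).
move=> [[v W] S] [[v' W'] S'] [_ /ffunP ec] x xn.
have {}xn : (3 <= val x)%N by case/orP: xn => [/eqP->|].
by have := ec x; rewrite !ffunE /= xn => -[].
Qed.

End Construction.

Theorem theorem2 (N K : nat) (F : finFieldType) (R : realType) :
  (3 <= N)%N -> (2 <= K)%N ->
  exists Sc : scheme N K F R,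
    valid_scheme Sc /\
    rate Sc = 2%:R / (3 * K)%:R /\
    equal_dedicated_loads Sc /\
    load_ratio Sc = 2%:R / 3%:R /\
    (cr_len Sc)%:R = ((K ^ 2 * msg_len Sc)%:R / 2%:R : rat).
Proof.
move=> N3; case: K => [|[|k]] // _; exists (balanced_scheme k F R N3).
split; first exact: scheme_valid.
have k0 : (k.+2%:R : rat) != 0 by rewrite pnatr_eq0.
(* Six message symbols cost 2K + 2K + 2K + 3K = 9K downloaded ones, and there are 3K^2 masks. *)
rewrite /rate /total_download /load_ratio /= /blocks /= -!mulnDl !natrM.
by move: (k.+2%:R : rat) k0 => x k0; do ![split]; field; rewrite ?k0.
Qed.
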